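(* Let $I=\sqrt{-1}$. For every nonnegative integer $k$, $$ A_{4k}(t,q,I)=\frac{(t;q)_{4k+1}}{(t;q^4)_{k+1}}\,A_k(t,q^4). $$
   Context: $t,q,p$ are indeterminates. $\mathfrak{S}_n$ is the symmetric group on $\{1,\dots,n\}$. For $\sigma=\sigma_1\cdots\sigma_n\in\mathfrak{S}_n$ (one-line notation): $\mathrm{inv}(\sigma)=\#\{(i,j)\mid 1\le i<j\le n,\ \sigma_i>\sigma_j\}$, $\mathrm{des}(\sigma)=\#\{i\mid 1\le i\le n-1,\ \sigma_i>\sigma_{i+1}\}$, and $\mathrm{maj}(\sigma)=\sum\{i\mid 1\le i\le n-1,\ \sigma_i>\sigma_{i+1}\}$ (the sum of the descent positions). Define $$A_n(t,q,p)=\sum_{\sigma\in\mathfrak{S}_n}t^{\mathrm{des}(\sigma)}q^{\mathrm{maj}(\sigma)}p^{\mathrm{inv}(\sigma)},\qquad A_n(t,q):=A_n(t,q,1),\qquad A_0=1.$$ $A_k(t,q^4)$ is $A_k(t,q)$ with $q$ replaced by $q^4$. The $q$-ascending factorial is $(a;q)_0=1$, $(a;q)_n=(1-a)(1-aq)\cdots(1-aq^{n-1})$ for $n\ge1$. *)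

(* Defs.v *)
From HB Require Import structures.
From mathcomp Require Import all_boot all_order all_algebra all_fingroup.
From mathcomp Require Import mpoly.

Set Implicit Arguments.
Unset Strict Implicit.
Unset Printing Implicit Defensive.

Import GRing.Theory.

Local Open Scope ring_scope.

Section PermutationStatistics.

Variables (n : nat) (s : 'S_n).

Definition inv : nat :=
  #|[set ij : 'I_n * 'I_n | (ij.1 < ij.2)%N && (s ij.2 < s ij.1)%N]|.

(* Letters and positions are numbered from 0, so that i : 'I_n stands for the
   position i.+1 of the one-line notation of s. *)
Definition descents : {set 'I_n} :=
  [set i : 'I_n | [exists j : 'I_n, (j == i.+1 :> nat) && (s j < s i)%N]].

Definition des : nat := #|descents|.

Definition maj : nat := (\sum_(i in descents) i.+1)%N.

End PermutationStatistics.

(* The value of A_n at elements t, q, p of a commutative ring; the polynomial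
   itself is obtained by taking indeterminates for t, q and p. *)
Definition A3 (R : comNzRingType) (n : nat) (t q p : R) : R :=
  \sum_(s : 'S_n) t ^+ des s * q ^+ maj s * p ^+ inv s.

Definition A2 (R : comNzRingType) (n : nat) (t q : R) : R := A3 n t q 1.

Definition qfact (R : comNzRingType) (a q : R) (n : nat) : R :=
  \prod_(i < n) (1 - a * q ^+ i).

(* The field C(t, q) of rational functions in two indeterminates. *)
Definition ratfun (C : fieldType) := {fraction {mpoly C[2]}}.

Definition ratfun_const (C : fieldType) (c : C) : ratfun C := tofrac c%:MP.

Definition tvar (C : fieldType) : ratfun C := tofrac 'X_(0 : 'I_2).
Definition qvar (C : fieldType) : ratfun C := tofrac 'X_(1 : 'I_2).

Lemma A3_0 (R : comNzRingType) (t q p : R) : A3 0 t q p = 1.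
Proof.
rewrite /A3 (bigD1 (1%g : 'S_0)) //= big1 ?addr0 => [|s /eqP[]].
  rewrite /inv /maj /des (_ : descents _ = set0); last by apply/setP=> -[].
  rewrite big_set0 cards0 (_ : [set ij | _] = set0) ?cards0 ?mulr1 //.
  by apply/setP=> -[[]].
by apply/permP=> -[].
Qed.

(* Main.v *)
(* Write A_n for A_n(t, q, p), and put g_n = A_n / (t;q)_(n+1).  Building the
   permutations by appending a last letter yields a recurrence for the
   generating functions refined by the last letter, whose solution is explicit
   in terms of Gaussian binomials.  Summing over the last letter,
     (1 - t q^n) g_n = sum_(m < n) x_m [n choose m]_p g_m,
   where x_0 = 1 and x_m = t q^m for m > 0; this determines g.
   At p = I the Gaussian binomial [4k choose m]_p is 0 unless 4 divides m, and
   it is then the ordinary binomial of k and m / 4 (q-Lucas).  Hence g_(4k) at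
   (t, q, I) and g_k at (t, q^4, 1) obey the same recurrence. *)

Require Import Defs.
From HB Require Import structures.
From mathcomp Require Import all_boot all_order all_algebra all_fingroup.
From mathcomp Require Import mpoly.
From mathcomp Require Import ring zify.

Set Implicit Arguments.
Unset Strict Implicit.
Unset Printing Implicit Defensive.

Import GRing.Theory Num.Theory.

Local Open Scope ring_scope.

(** * Gaussian binomials, and their values when p^2 = -1 *)

Section GaussianBinomial.

Variable R : comNzRingType.
Implicit Types (p : R) (n m : nat).

Fixpoint qbinom p n m : R :=
  match n, m with
  | _, 0 => 1
  | 0, _.+1 => 0
  | n'.+1, m'.+1 => p ^+ m'.+1 * qbinom p n' m'.+1 + qbinom p n' m'
  end.

Lemma qbinom0 p n : qbinom p n 0 = 1.
Proof. by case: n. Qed.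

Lemma qbinomS p n m :
  qbinom p n.+1 m.+1 = p ^+ m.+1 * qbinom p n m.+1 + qbinom p n m.
Proof. by []. Qed.

Lemma qbinom1 n m : qbinom 1 n m = 'C(n, m)%:R.
Proof.
elim: n m => [|n IHn] [|m] //=.
by rewrite expr1n mul1r !IHn binS natrD.
Qed.

Lemma qbinom_add4_small p n m :
  p ^+ 2 = -1 -> (m < 4)%N -> qbinom p n.+4 m = qbinom p n m.
Proof.
move=> p2; case: m => [|[|[|[|//]]]] _ //; rewrite !(qbinomS, qbinom0).
all: by ring: p2.
Qed.

(* In general the coefficients are, up to powers of p, the Gaussian binomials
   of 4 and i; those with 0 < i < 4 vanish at a primitive fourth root of 1. *)
Lemma qbinom_add4 p n m : p ^+ 2 = -1 ->
  qbinom p n.+4 m.+4 = qbinom p n m.+4 + qbinom p n m.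
Proof.
move=> p2; have p4 : p ^+ 4 = 1 by ring: p2.
have pm4 : (p ^+ m) ^+ 4 = 1 by rewrite -exprM mulnC exprM p4 expr1n.
rewrite !qbinomS !exprS; move: (p ^+ m) pm4 => x x4.
by ring: p2 x4.
Qed.

(** By [qbinom_add4], raising the upper index by 4 acts as Pascal's rule on [m %/ 4]. *)
Lemma qbinom_mul4 p n m : p ^+ 2 = -1 ->
  qbinom p (4 * n) m = if (4 %| m)%N then 'C(n, m %/ 4)%:R else 0.
Proof.
move=> p2; elim: n m => [|n IHn] m.
  case: m => [|m] //=; case: ifP => // /dvdnP[[|d] //= ->].
  by rewrite mulnK.
rewrite mulnS; case: (ltnP m 4) => [lt_m4 | /subnKC <-].
  rewrite -[(4 + _)%N]/(4 * n).+4 qbinom_add4_small // IHn.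
  by case: m lt_m4 => [|[|[|[|]]]] //; rewrite !bin0.
rewrite -[X in qbinom p X _]/(4 * n).+4 -[X in qbinom p _ X]/(m - 4).+4.
rewrite qbinom_add4 // !IHn -[(m - 4).+4]/(4 + (m - 4))%N.
rewrite dvdn_addr // divnDl // divnn /= add1n binS natrD.
by case: ifP; rewrite ?addr0.
Qed.

End GaussianBinomial.

(** * Appending a last letter: effect on inversions and descents *)

Lemma sum_lift_perm (V : nmodType) n (F : 'S_n.+1 -> V) :
  \sum_s F s = \sum_j \sum_(s : 'S_n) F (lift_perm ord_max j s).
Proof.
rewrite pair_big /= (reindex (fun u => lift_perm ord_max u.1 u.2)) //=.
(* Injectivity suffices, since both sides have (n+1)! elements. *)
apply/onW_bij/inj_card_bij => [[j s] [j' s'] /= /permP eq_l | ].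
  have := eq_l ord_max; rewrite !lift_perm_id => eq_j; move: eq_l.
  rewrite eq_j => eq_l; congr pair; apply/permP=> i.
  by have := eq_l (lift ord_max i); rewrite !lift_perm_lift => /lift_inj.
by rewrite card_prod !card_Sn card_ord factS.
Qed.

Lemma widen_lift_max n (i : 'I_n) : widen_ord (leqnSn n) i = lift ord_max i.
Proof. by apply: val_inj; rewrite [RHS]lift_max. Qed.

Lemma inv_sum n (s : 'S_n) :
  Defs.inv s =
    (\sum_(i < n) \sum_(k < n) ((i < k)%N && (s k < s i)%N : nat))%N.
Proof.
rewrite /Defs.inv -sum1dep_card pair_bigA /= big_mkcond /=.
by apply: eq_bigr => -[i k] _ /=; case: ifP.
Qed.

Lemma inv_lift_perm n (j : 'I_n.+1) (s : 'S_n) :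
  Defs.inv (lift_perm ord_max j s) = (Defs.inv s + (n - j))%N.
Proof.
rewrite !inv_sum big_ord_recr /= [X in (_ + X)%N]big1 ?addn0; last first.
  by move=> k _; rewrite ltnNge -ltnS ltn_ord.
(* The letters of [s] that end up above the new last letter are those at least [j]; [s] permutes 0,
   ..., n-1, so there are n - j of them. *)
have -> : (n - j = \sum_(i < n) (j <= s i)%N)%N.
  rewrite -(reindex_inj (@perm_inj _ s) (P := predT)
              (F := fun i : 'I_n => nat_of_bool (j <= i)%N)) /=.
  rewrite -(big_mkord xpredT (fun i => nat_of_bool (j <= i)%N)).
  rewrite (@big_cat_nat _ _ _ j) //= ?leq_ord //.
  rewrite big_nat_cond big1 => [|i /andP[/andP[_ ltij] _]]; last first.
    by rewrite leqNgt ltij.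
  rewrite big_nat_cond (eq_bigr (fun=> 1%N)) => [|i /andP[/andP[leji _] _]].
    by rewrite -big_nat_cond sum_nat_const_nat muln1.
  by rewrite leji.
rewrite -big_split; apply: eq_bigr => i _ /=.
rewrite big_ord_recr /= lift_perm_id widen_lift_max lift_perm_lift.
congr (_ + _)%N.
  apply: eq_bigr => k _; rewrite widen_lift_max lift_perm_lift.
  by rewrite /= !ltnNge !leq_bump2.
by rewrite ltn_ord /= /bump; lia.
Qed.

Lemma max_notin_descents n (s : 'S_n.+1) : ord_max \notin descents s.
Proof.
rewrite inE; apply/existsP=> -[k /andP[/eqP def_k _]].
by have := ltn_ord k; rewrite def_k ltnn.
Qed.

Lemma lift_in_descents n (j : 'I_n.+1) (s : 'S_n) (i : 'I_n) :
  (lift ord_max i \in descents (lift_perm ord_max j s)) =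
    (i \in descents s) || (i.+1 == n) && (j <= s i)%N.
Proof.
rewrite !inE lift_perm_lift; apply/existsP/orP => [[k]|].
  case: (unliftP ord_max k) => [k'|] ->; last first.
    rewrite lift_perm_id lift_max /= => /andP[/eqP <- lt_j]; right.
    by rewrite eqxx; move: lt_j; rewrite /bump; lia.
  rewrite lift_perm_lift !lift_max /= => /andP[eq_k lt_s]; left.
  apply/existsP; exists k'; rewrite eq_k.
  by move: lt_s; rewrite !ltnNge leq_bump2.
case=> [/existsP[k /andP[eq_k lt_s]] | /andP[/eqP eq_n le_j]].
  exists (lift ord_max k); rewrite lift_perm_lift !lift_max eq_k /=.
  by move: lt_s; rewrite !ltnNge leq_bump2.
exists ord_max; rewrite lift_perm_id lift_max /= eq_n eqxx /=.
by rewrite /bump; lia.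
Qed.

(* Appending to s the letter j, and shifting up the letters of s that are at
   least j, creates a descent. *)
Definition last_ge n (s : 'S_n) (j : nat) :=
  [exists i : 'I_n, (i.+1 == n) && (j <= s i)%N].

(** * Weighted sums over permutations, refined by the last letter *)

Section Weights.

Variables (R : comNzRingType) (x : nat -> R) (p : R).
Implicit Types (n m j : nat).

Definition weight n (s : 'S_n) : R :=
  \prod_(i in descents s) x i.+1 * p ^+ Defs.inv s.

Lemma prod_descents_lift n (j : 'I_n.+1) (s : 'S_n) :
  \prod_(i in descents (lift_perm ord_max j s)) x i.+1 =
    \prod_(i in descents s) x i.+1 * (if last_ge s j then x n else 1).
Proof.
have -> : (if last_ge s j then x n else 1) =
    \prod_(i < n) if (i.+1 == n) && (j <= s i)%N then x i.+1 else 1.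
  case: ifP => [/existsP[i /andP[/eqP eq_n le_j]] | /negbT/existsPn no_i].
    rewrite (bigD1 i) //= eq_n eqxx le_j /= big1 ?mulr1 // => i' ne_i.
    case: ifP => // /andP[/eqP eq_n' _]; case/eqP: ne_i.
    by apply/val_inj/succn_inj; exact: etrans eq_n' (esym eq_n).
  by rewrite big1 // => i _; rewrite (negPf (no_i i)).
rewrite [in LHS]big_mkcond big_ord_recr /= (negPf (max_notin_descents _)) mulr1.
rewrite [X in _ = X * _]big_mkcond -big_split; apply: eq_bigr => i _ /=.
rewrite widen_lift_max lift_in_descents.
(* A descent of [s] is never at its last position, so the old and the new descent do not overlap. *)
case: (boolP (i \in _)) => [|_] /=; last by rewrite mul1r.
rewrite inE => /existsP[k /andP[/eqP eq_k _]]; case: ifP => [|_]; last first.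
  by rewrite mulr1.
by move=> /andP[/eqP eq_n _]; have := ltn_ord k; rewrite eq_k eq_n ltnn.
Qed.

Lemma weight_lift_perm n (j : 'I_n.+1) (s : 'S_n) :
  weight (lift_perm ord_max j s) =
    p ^+ (n - j) * ((if last_ge s j then x n else 1) * weight s).
Proof.
by rewrite /weight prod_descents_lift inv_lift_perm exprD; ring.
Qed.

Definition eulerian n : R := \sum_(s : 'S_n) weight s.

(** The empty permutation has no last letter and is counted for every [j]. *)
Definition eulerian_lt n j : R := \sum_(s : 'S_n | ~~ last_ge s j) weight s.

(** Last letters at least [j] contribute the complement of [eulerian_lt n j], so one refined sum
    suffices. *)
Lemma sum_weight_append n j :
  \sum_(s : 'S_n) (if last_ge s j then x n else 1) * weight s =
    x n * eulerian n + (1 - x n) * eulerian_lt n j.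
Proof.
rewrite /eulerian (bigID (fun s => last_ge s j)) /=.
rewrite [in RHS](bigID (fun s => last_ge s j)) /= -/(eulerian_lt n j).
rewrite (eq_bigr (fun s => x n * weight s)) => [|s ->] //.
rewrite -mulr_sumr [X in _ + X](eq_bigr (@weight n)) => [|s /negPf->].
  by rewrite -/(eulerian_lt n j); ring.
by rewrite mul1r.
Qed.

Lemma last_ge_ord_max n (s : 'S_n.+1) j : last_ge s j = (j <= s ord_max)%N.
Proof.
apply/existsP/idP => [[i /andP[/eqP[eq_n] le_j]] | le_j].
  by rewrite (_ : ord_max = i) //; apply: val_inj.
by exists ord_max; rewrite eqxx.
Qed.

(** Removing a last letter [i] removes its n - i inversions and the descent, if any, that it
    creates. *)
Lemma eulerian_ltS n j : (j <= n.+1)%N ->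
  eulerian_lt n.+1 j =
    \sum_(i < j) p ^+ (n - i) *
      (x n * eulerian n + (1 - x n) * eulerian_lt n i).
Proof.
move=> le_j; rewrite /eulerian_lt big_mkcond sum_lift_perm.
rewrite (big_ord_widen _ (fun i => p ^+ (n - i) * (x n * eulerian n
  + (1 - x n) * eulerian_lt n i)) le_j) [RHS]big_mkcond.
apply: eq_bigr => i _; rewrite -sum_weight_append mulr_sumr.
under eq_bigr do rewrite last_ge_ord_max lift_perm_id -ltnNge.
case: ifP => _; last by rewrite big1.
by apply: eq_bigr => s _; rewrite weight_lift_perm.
Qed.

Lemma eulerian_lt_top n : eulerian_lt n.+1 n.+1 = eulerian n.+1.
Proof.
by apply: eq_bigl => s; rewrite last_ge_ord_max -ltnNge ltn_ord.
Qed.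

Lemma eulerian_lt0 n : eulerian_lt n.+1 0 = 0.
Proof. by rewrite eulerian_ltS // big_ord0. Qed.

Lemma eulerian_lt_recr n j : (j <= n)%N ->
  eulerian_lt n.+1 j.+1 = eulerian_lt n.+1 j + p ^+ (n - j) *
    (x n * eulerian n + (1 - x n) * eulerian_lt n j).
Proof.
by move=> le_j; rewrite !eulerian_ltS ?big_ord_recr //= ltnW.
Qed.

(** Descents have positions at least 1; this value at 0 gives the summand m = 0 below the form of
    the others. *)
Hypothesis x0 : x 0 = 1.

(* By inclusion-exclusion on the descents, the summand of index m comes from
   the permutations that are increasing after position m: there
   p ^ ((n.+1 - m) * (n.+1 - j)) * qbinom p j (n.+1 - m) counts the choices of
   the last n.+1 - m letters, all smaller than j, by the inversions in which
   they are the smaller letter. *)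
Lemma eulerian_ltE n j : (j <= n.+1)%N ->
  eulerian_lt n.+1 j =
    \sum_(m < n.+1) x m * \prod_(m.+1 <= i < n.+1) (1 - x i) * eulerian m *
      (p ^+ ((n.+1 - m) * (n.+1 - j)) * qbinom p j (n.+1 - m)).
Proof.
elim: n j => [|n IHn].
  case=> [|[|//]] _; first by rewrite eulerian_lt0 big_ord1 mulr0 mulr0.
  by rewrite eulerian_lt_recr // eulerian_lt0 big_ord1 big_geq // x0 /=; ring.
elim=> [|j IHj] le_j.
  rewrite eulerian_lt0 big1 // => m _.
  by rewrite subSn ?leq_ord //= !mulr0.
rewrite eulerian_lt_recr // IHj ?(ltnW le_j) // IHn //.
pose c m := x m * \prod_(m.+1 <= i < n.+2) (1 - x i) * eulerian m.
(* The factor [1 - x n.+1] extends every product by one index; the first term is the new summand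
   [m = n.+1], with empty product. *)
have -> : x n.+1 * eulerian n.+1 + (1 - x n.+1) *
    (\sum_(m < n.+1) x m * \prod_(m.+1 <= i < n.+1) (1 - x i) * eulerian m *
      (p ^+ ((n.+1 - m) * (n.+1 - j)) * qbinom p j (n.+1 - m))) =
    \sum_(m < n.+2)
      c m * (p ^+ ((n.+1 - m) * (n.+1 - j)) * qbinom p j (n.+1 - m)).
  rewrite [RHS]big_ord_recr /= /c big_geq // subnn mul0n qbinom0.
  rewrite [LHS]addrC; congr (_ + _); last by ring.
  rewrite mulr_sumr; apply: eq_bigr => m _.
  by rewrite [in RHS]big_nat_recr /= ?ltn_ord //; ring.
(* Term by term this is [qbinomS] at [j] and [n.+1 - m], multiplied by a power of [p]. *)
rewrite mulr_sumr -big_split; apply: eq_bigr => m _ /=.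
rewrite -/(c m) subSS (subSn (leq_ord m)) [(n.+2 - j)%N]subSn //.
by rewrite !(mulSn, mulnS) !exprS !exprD; ring.
Qed.

(** For [j = n.+1] the last letter is unrestricted and the power of [p] is 1. *)
Lemma eulerian_rec n :
  eulerian n.+1 =
    \sum_(m < n.+1) x m * \prod_(m.+1 <= i < n.+1) (1 - x i) * eulerian m *
      qbinom p n.+1 (n.+1 - m).
Proof.
rewrite -eulerian_lt_top eulerian_ltE //; apply: eq_bigr => m _.
by rewrite subnn muln0 mul1r.
Qed.

End Weights.

(** * The quotients g_n and their recurrence *)

Lemma qfactS (R : comNzRingType) (a q : R) n :
  qfact a q n.+1 = qfact a q n * (1 - a * q ^+ n).
Proof. by rewrite /qfact big_ord_recr. Qed.

Section Quotients.

Variables (F : fieldType) (t q p : F).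
Hypothesis tq_neq1 : forall n, 1 - t * q ^+ n != 0.

Lemma qfact_neq0 n : qfact t q n != 0.
Proof. by apply/prodf_neq0 => i _. Qed.

Definition A3_quot n := A3 n t q p / qfact t q n.+1.

(* Not t at m = 0: position 0 is never a descent. *)
Definition split_weight m := if m is 0 then 1 else t * q ^+ m.

Lemma A3E n : A3 n t q p = eulerian split_weight p n.
Proof.
apply: eq_bigr => s _; rewrite /weight /des /maj /split_weight.
rewrite big_split prodr_const; congr (_ * _ * _).
by rewrite -expr_sum.
Qed.

Lemma A3_quot0 : A3_quot 0 = (1 - t)^-1.
Proof. by rewrite /A3_quot A3_0 qfactS /qfact big_ord0 expr0 mulr1 !mul1r. Qed.

Lemma A3_quot_rec n : (0 < n)%N ->
  (1 - t * q ^+ n) * A3_quot n =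
    \sum_(m < n) split_weight m * qbinom p n (n - m) * A3_quot m.
Proof.
case: n => // n _; have tq0 := tq_neq1 n.+1; have qf0 := qfact_neq0 n.+1.
(* After multiplication by (t;q)_(n+1) the left side is A_(n+1) itself. *)
apply: (mulfI qf0).
transitivity (A3 n.+1 t q p).
  by rewrite /A3_quot [qfact t q n.+2]qfactS; field; rewrite tq0 qf0.
rewrite A3E eulerian_rec // mulr_sumr; apply: eq_bigr => m _.
rewrite /A3_quot -A3E.
(* The indices i > m are positive, so there [split_weight i] is t q^i. *)
have -> : qfact t q n.+1 =
    qfact t q m.+1 * \prod_(m.+1 <= i < n.+1) (1 - split_weight i).
  rewrite /qfact -!(big_mkord xpredT (fun i => 1 - t * q ^+ i)).
  rewrite (@big_cat_nat _ _ _ m.+1) //=; congr (_ * _).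
  by rewrite !big_nat; apply: eq_bigr => -[].
by field; rewrite qfact_neq0.
Qed.

End Quotients.

(** * Comparison of the two recurrences when p^2 = -1 *)

Lemma sum_mul4 (V : nmodType) k (f : nat -> V) :
  \sum_(m < 4 * k | (4 %| m)%N) f m = \sum_(j < k) f (4 * j)%N.
Proof.
rewrite -[LHS](big_mkord (dvdn 4)).
rewrite -[RHS](big_mkord xpredT (fun j => f (4 * j)%N)).
elim: k => [|k IHk]; first by rewrite !big_geq.
rewrite big_nat_recr //= -IHk [(4 * k.+1)%N]mulnS.
rewrite (@big_cat_nat _ _ _ (4 * k)) ?leq_addl //=; congr (_ + _).
rewrite -{1}[(4 * k)%N]add0n big_addn addnK.
have dvdn4 i : (4 %| i + 4 * k)%N = (4 %| i)%N by rewrite dvdn_addl ?dvdn_mulr.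
by rewrite (eq_bigl _ _ dvdn4) /index_iota /= !big_cons big_nil /= add0n !addr0.
Qed.

Section FourthRoot.

Variables (F : fieldType) (t q p : F).
Hypothesis tq_neq1 : forall n, 1 - t * q ^+ n != 0.
Hypothesis p2 : p ^+ 2 = -1.

Lemma A3_quot_mul4 k : A3_quot t q p (4 * k) = A3_quot t (q ^+ 4) 1 k.
Proof.
have tq4_neq1 n : 1 - t * (q ^+ 4) ^+ n != 0 by rewrite -exprM.
elim/ltn_ind: k => -[|k] IHk; first by rewrite !A3_quot0.
(* Both recurrences have this left factor, as q^(4(k+1)) = (q^4)^(k+1). *)
apply: (mulfI (tq_neq1 (4 * k.+1))).
rewrite A3_quot_rec // [q ^+ _ in RHS]exprM A3_quot_rec //.
under eq_bigr do rewrite qbinom_mul4 //.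
(* 4 divides 4(k+1) - m exactly when it divides m, so only multiples of 4 survive. *)
rewrite (eq_bigr (fun m : 'I_(4 * k.+1) => if (4 %| m)%N then
    split_weight t q m * 'C(k.+1, (4 * k.+1 - m) %/ 4)%:R * A3_quot t q p m
    else 0)) => [|m _]; last first.
  rewrite dvdn_subr ?dvdn_mulr ?(ltnW (ltn_ord m)) //.
  by case: ifP => // _; rewrite mulr0 mul0r.
rewrite -big_mkcond (sum_mul4 _ (fun m => split_weight t q m *
  'C(k.+1, (4 * k.+1 - m) %/ 4)%:R * A3_quot t q p m)).
apply: eq_bigr => j _; rewrite qbinom1 -mulnBr mulKn // IHk //.
(* The weights t q^(4j) and t (q^4)^j agree for j > 0, and at 0 both are 1. *)
congr (_ * _ * _); case: (nat_of_ord j) => // i.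
by rewrite /split_weight exprM.
Qed.

End FourthRoot.

(** * Rational functions in t and q *)

Lemma tvar_qvar_neq1 (C : fieldType) n : 1 - tvar C * qvar C ^+ n != 0.
Proof.
rewrite -tofracXn -tofracM -tofrac1 -tofracB tofrac_eq0.
(* The polynomial takes the value 1 at the origin. *)
apply/eqP => /(congr1 (fun f : {mpoly C[2]} => f.@[fun=> 0])).
rewrite !rmorphE /= mevalM mevalXU mul0r subr0.
by apply/eqP; rewrite oner_eq0.
Qed.

Theorem corollary2 (C : numClosedFieldType) (k : nat) :
  let t := tvar C in
  let q := qvar C in
  let I := ratfun_const 'i in
  A3 (4 * k) t q I =
    qfact t q (4 * k).+1 / qfact t (q ^+ 4) k.+1 * A2 k t (q ^+ 4).
Proof.
move=> t q I; have tq_neq1 n : 1 - t * q ^+ n != 0 by exact: tvar_qvar_neq1.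
have I2 : I ^+ 2 = -1.
  by rewrite /I /ratfun_const -tofracXn -rmorphXn sqrCi rmorphN1 tofracN tofrac1.
have := A3_quot_mul4 tq_neq1 I2 k.
rewrite /A3_quot -/(A2 _ _ _) => eq_quot.
rewrite -mulrA [_^-1 * _]mulrC -eq_quot mulrC divfK //.
exact: qfact_neq0.
Qed.
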